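(* Let $\Omega\subset\mathbb{R}^n$ and $D\subset\mathbb{R}^m$ be domains and let $f:\Omega\times D\to\mathbb{R}^n$ be analytic. Let $(x^0,\alpha^0)\in\Omega\times D$ satisfy $x^0=f(x^0,\alpha^0)$ and $\|\partial_x f(x^0,\alpha^0)\|<1$, and let $\varphi:D_1\to\Omega$ be an analytic path of asymptotically stable steady states of $x_{k+1}=f(x_k,\alpha)$, where $D_1\subset D$ is a maximal domain containing $\alpha^0$ on which there is such a path with $\varphi(\alpha^0)=x^0$ and $\|\partial_x f(\varphi(\alpha),\alpha)\|<1$ for all $\alpha\in D_1$. Then for any two steady states $\varphi(\alpha^{\star})$ and $\varphi(\alpha^{\star\star})$ belonging to the path $\varphi$ (with $\alpha^{\star},\alpha^{\star\star}\in D_1$), there exist a finite number of values of the control parameters $\alpha^1,\alpha^2,\dots,\alpha^p\in D_1$ such that all the maneuvers $$\alpha^{\star}\to\alpha^1\to\alpha^2\to\cdots\to\alpha^p\to\alpha^{\star\star}$$ are successful on the path $\varphi$.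
   Context: A domain is a nonempty connected open set. ''Analytic'' means real analytic. The system is the discrete dynamical system with control $x_{k+1}=f(x_k,\alpha)$, $k=0,1,2,\dots$, with state $x\in\Omega$ and control parameter $\alpha\in D$. $f^k(x,\alpha)$ denotes the $k$-th iterate of the map $f(\cdot,\alpha)$ applied to $x$ (with $f^0(x,\alpha)=x$); statements about the sequence $f^k(x,\alpha)$, $k\ge 0$, include that all these iterates are defined, i.e. remain in $\Omega$. $\|\cdot\|$ is the Euclidean norm on $\mathbb{R}^n$ and the induced operator norm on matrices; $\partial_x f$ is the Jacobian matrix of $f$ with respect to $x$. A state $x^*\in\Omega$ is a steady state for the control $\alpha\in D$ if $x^*=f(x^*,\alpha)$. It is stable if for every $\varepsilon>0$ there is $\delta>0$ such that $\|x-x^*\|<\delta$, $x\in\Omega$, implies $\|f^k(x,\alpha)-x^*\|<\varepsilon$ for all $k\ge 0$. It is asymptotically stable if in addition there is $r>0$ such that $f^k(x,\alpha)\to x^*$ as $k\to\infty$ for all $x$ in the ball $B(x^*,r)$. An analytic path of steady states is an analytic function $\varphi:D_1\subset D\to\Omega$ with $\varphi(\alpha)=f(\varphi(\alpha),\alpha)$ for all $\alpha\in D_1$. It is an analytic path of asymptotically stable steady states if, for every $\alpha\in D_1$, $\varphi(\alpha)$ is an asymptotically stable steady state for the control $\alpha$. A maneuver $\alpha'\to\alpha''$ is a change of control parameter from $\alpha'$ to $\alpha''$. It is successful on the path $\varphi:D_1\to\Omega$ if $\alpha',\alpha''\in D_1$ and the sequence defined by $x_0=\varphi(\alpha')$,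 $x_{k+1}=f(x_k,\alpha'')$ tends to $\varphi(\alpha'')$ as $k\to\infty$. In the displayed chain, each arrow denotes one maneuver, and each of these maneuvers is to be successful. ''Maximal'' is with respect to inclusion among domains contained in $D$ and containing $\alpha^0$. *)

(* Defs.v *)
From HB Require Import structures.
From mathcomp Require Import all_boot all_order all_algebra.
From mathcomp Require Import all_classical all_reals all_analysis.

Set Implicit Arguments.
Unset Strict Implicit.
Unset Printing Implicit Defensive.

Import Order.TTheory GRing.Theory Num.Theory.
Import numFieldNormedType.Exports.

Local Open Scope classical_set_scope.
Local Open Scope ring_scope.

(** The library norm on ['rV[R]_n] is the sup norm, so the Euclidean norm is
    defined here; both induce the same topology, hence [open], [connected] and
    [-->] below are the usual notions of R^n. *)
Definition eucl_norm (R : realType) (n : nat) (v : 'rV[R]_n) : R :=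
  Num.sqrt (\sum_(i < n) v 0 i ^+ 2).

(** Vectors are rows and matrices act on the right, as in the library's
    jacobian, which satisfies ['D_v g a = v *m 'J g a]. *)
Definition op_norm (R : realType) (n p : nat) (A : 'M[R]_(n, p)) : R :=
  sup [set eucl_norm (v *m A) | v in [set v : 'rV[R]_n | eucl_norm v <= 1]].

Definition is_domain (T : topologicalType) (A : set T) : Prop :=
  [/\ A !=set0, open A & connected A].

Definition monomial (R : realType) (n : nat)
    (y : 'rV[R]_n) (nu : {ffun 'I_n -> nat}) : R :=
  \prod_(i < n) y 0 i ^+ nu i.

(** Real analyticity at [a]: near [a], [g] is the sum of an absolutely
    convergent power series in [x - a], indexed by the multi-indices [nu].
    By absolute convergence the sum does not depend on the order of summation;
    it is computed here along the cubes [{0, .., K-1}^n] of multi-indices. *)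
Definition analytic_at (R : realType) (n : nat)
    (g : 'rV[R]_n -> R) (a : 'rV[R]_n) : Prop :=
  exists c : {ffun 'I_n -> nat} -> R, \forall x \near a,
    summable [set: {ffun 'I_n -> nat}]
      (fun nu => (c nu * monomial (x - a) nu)%:E) /\
    (fun K : nat => \sum_(nu : {ffun 'I_n -> 'I_K})
       let mu := [ffun i => nat_of_ord (nu i)] in c mu * monomial (x - a) mu)
      @ \oo --> g x.

Definition analytic_on (R : realType) (n p : nat)
    (A : set 'rV[R]_n) (g : 'rV[R]_n -> 'rV[R]_p) : Prop :=
  forall a, A a -> forall j : 'I_p, analytic_at (fun x => g x 0 j) a.

(** Joint analyticity of a map of two variables on [Omega x D], a subset of
    R^n x R^m = R^(n + m). *)
Definition analytic2_on (R : realType) (n m p : nat)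
    (Omega : set 'rV[R]_n) (D : set 'rV[R]_m)
    (f : 'rV[R]_n -> 'rV[R]_m -> 'rV[R]_p) : Prop :=
  analytic_on
    [set z : 'rV[R]_(n + m) | Omega (lsubmx z) /\ D (rsubmx z)]
    (fun z => f (lsubmx z) (rsubmx z)).

Definition partial_jacobian (R : realType) (n m p : nat)
    (f : 'rV[R]_n -> 'rV[R]_m -> 'rV[R]_p)
    (x : 'rV[R]_n) (alpha : 'rV[R]_m) : 'M[R]_(n, p) :=
  'J (f ^~ alpha) x.

(** [f] is a total function whose values matter only on [Omega x D];
    [iterates_defined] says that the trajectory never leaves [Omega]. *)
Definition iterate (R : realType) (n m : nat)
    (f : 'rV[R]_n -> 'rV[R]_m -> 'rV[R]_n)
    (k : nat) (x : 'rV[R]_n) (alpha : 'rV[R]_m) : 'rV[R]_n :=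
  iter k (f ^~ alpha) x.

Definition iterates_defined (R : realType) (n m : nat) (Omega : set 'rV[R]_n)
    (f : 'rV[R]_n -> 'rV[R]_m -> 'rV[R]_n)
    (x : 'rV[R]_n) (alpha : 'rV[R]_m) : Prop :=
  forall k : nat, Omega (iterate f k x alpha).

Definition steady_state (R : realType) (n m : nat)
    (Omega : set 'rV[R]_n) (D : set 'rV[R]_m)
    (f : 'rV[R]_n -> 'rV[R]_m -> 'rV[R]_n)
    (xs : 'rV[R]_n) (alpha : 'rV[R]_m) : Prop :=
  [/\ Omega xs, D alpha & xs = f xs alpha].

Definition stable (R : realType) (n m : nat)
    (Omega : set 'rV[R]_n) (D : set 'rV[R]_m)
    (f : 'rV[R]_n -> 'rV[R]_m -> 'rV[R]_n)
    (xs : 'rV[R]_n) (alpha : 'rV[R]_m) : Prop :=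
  steady_state Omega D f xs alpha /\
  forall eps : R, 0 < eps -> exists2 delta : R, 0 < delta &
    forall x, Omega x -> eucl_norm (x - xs) < delta ->
      iterates_defined Omega f x alpha /\
      forall k : nat, eucl_norm (iterate f k x alpha - xs) < eps.

Definition asymptotically_stable (R : realType) (n m : nat)
    (Omega : set 'rV[R]_n) (D : set 'rV[R]_m)
    (f : 'rV[R]_n -> 'rV[R]_m -> 'rV[R]_n)
    (xs : 'rV[R]_n) (alpha : 'rV[R]_m) : Prop :=
  stable Omega D f xs alpha /\
  exists2 r : R, 0 < r &
    forall x, eucl_norm (x - xs) < r ->
      iterates_defined Omega f x alpha /\
      (fun k : nat => iterate f k x alpha) @ \oo --> xs.

Definition analytic_path (R : realType) (n m : nat)
    (Omega : set 'rV[R]_n) (D : set 'rV[R]_m)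
    (f : 'rV[R]_n -> 'rV[R]_m -> 'rV[R]_n)
    (D1 : set 'rV[R]_m) (phi : 'rV[R]_m -> 'rV[R]_n) : Prop :=
  [/\ D1 `<=` D, analytic_on D1 phi,
      (forall alpha, D1 alpha -> Omega (phi alpha)) &
      forall alpha, D1 alpha -> phi alpha = f (phi alpha) alpha].

Definition analytic_path_as_stable (R : realType) (n m : nat)
    (Omega : set 'rV[R]_n) (D : set 'rV[R]_m)
    (f : 'rV[R]_n -> 'rV[R]_m -> 'rV[R]_n)
    (D1 : set 'rV[R]_m) (phi : 'rV[R]_m -> 'rV[R]_n) : Prop :=
  analytic_path Omega D f D1 phi /\
  forall alpha, D1 alpha ->
    asymptotically_stable Omega D f (phi alpha) alpha.

Definition contractive_path_from (R : realType) (n m : nat)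
    (Omega : set 'rV[R]_n) (D : set 'rV[R]_m)
    (f : 'rV[R]_n -> 'rV[R]_m -> 'rV[R]_n)
    (x0 : 'rV[R]_n) (alpha0 : 'rV[R]_m)
    (D1 : set 'rV[R]_m) (phi : 'rV[R]_m -> 'rV[R]_n) : Prop :=
  [/\ is_domain D1, D1 alpha0, analytic_path_as_stable Omega D f D1 phi,
      phi alpha0 = x0 &
      forall alpha, D1 alpha ->
        op_norm (partial_jacobian f (phi alpha) alpha) < 1].

(** Maximality concerns the domain only: a larger domain [D2] may carry any
    path [psi], not necessarily one given as an extension of [phi]. *)
Definition maximal_contractive_path_from (R : realType) (n m : nat)
    (Omega : set 'rV[R]_n) (D : set 'rV[R]_m)
    (f : 'rV[R]_n -> 'rV[R]_m -> 'rV[R]_n)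
    (x0 : 'rV[R]_n) (alpha0 : 'rV[R]_m)
    (D1 : set 'rV[R]_m) (phi : 'rV[R]_m -> 'rV[R]_n) : Prop :=
  contractive_path_from Omega D f x0 alpha0 D1 phi /\
  forall (D2 : set 'rV[R]_m) (psi : 'rV[R]_m -> 'rV[R]_n),
    contractive_path_from Omega D f x0 alpha0 D2 psi ->
    D1 `<=` D2 -> D2 = D1.

Definition successful_maneuver (R : realType) (n m : nat)
    (Omega : set 'rV[R]_n) (f : 'rV[R]_n -> 'rV[R]_m -> 'rV[R]_n)
    (D1 : set 'rV[R]_m) (phi : 'rV[R]_m -> 'rV[R]_n)
    (alpha' alpha'' : 'rV[R]_m) : Prop :=
  [/\ D1 alpha', D1 alpha'', iterates_defined Omega f (phi alpha') alpha'' &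
      (fun k : nat => iterate f k (phi alpha') alpha'') @ \oo --> phi alpha''].

(* Main.v *)
Require Import Defs.
From mathcomp Require Import all_boot all_order all_algebra.
From mathcomp Require Import all_classical all_reals all_analysis.
From mathcomp Require Import ring lra.
Import Order.TTheory GRing.Theory Num.Theory.
Import numFieldNormedType.Exports.
Local Open Scope classical_set_scope.
Local Open Scope ring_scope.

Set Implicit Arguments.
Unset Strict Implicit.
Unset Printing Implicit Defensive.

(** Around each parameter [a] of [D1], all maneuvers between nearby parameters
    are successful ([local_maneuvers]); since [D1] is connected, any two of its
    points are then joined by a finite chain of such short maneuvers
    ([connected_chain]).

    The local claim has to be uniform.  Asymptotic stability of each [phi c]
    gives a basin of attraction whose size may shrink as [c] approaches [a], so
    it does not show that [phi a] is attracted to [phi c].  What helps is that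
    the maps [f ^~ c], for all [c] near [a], contract the Euclidean distance on
    one and the same ball around [phi a], with one factor [q < 1]
    ([local_contraction]).  As [phi] is continuous, [phi b] lies well inside
    that ball when [b] is near [a], and its iterates under [f ^~ c] converge
    geometrically to the fixed point [phi c] without leaving the ball.

    The uniform contraction follows from strict differentiability of [f] at
    [(phi a, a)]: with [A] the derivative there, [f z - f w - A (z - w)] is at
    most [e |z - w|] for all [z] and [w] near the base point.  Taking [z] and
    [w] with the same parameter [c] leaves only the block of [A] acting on the
    state, which is the partial Jacobian at [(phi a, a)], of operator norm less
    than 1.  An analytic function is strictly differentiable because the
    difference of a monomial of degree [k >= 2] at two points of the ball of
    radius [s] is at most [k s^(k - 1)] times their distance; against the value
    [r^k] of the monomial at a fixed point of absolute convergence this gains a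
    factor [s], and summation over all monomials gives an error
    [O(s) |z - w|] ([analytic_strict_derivative]). *)

(** * Monomials near the origin *)

Definition degree (n : nat) (nu : {ffun 'I_n -> nat}) : nat := \sum_i nu i.

Definition unit_index (n : nat) (i : 'I_n) : {ffun 'I_n -> nat} :=
  [ffun j => nat_of_bool (j == i)].

Lemma unit_index_inj n : injective (@unit_index n).
Proof.
move=> i j /ffunP/(_ i); rewrite !ffunE eqxx.
by case: eqP.
Qed.

Lemma degree1P n (nu : {ffun 'I_n -> nat}) :
  degree nu = 1%N -> exists i, nu = unit_index i.
Proof.
move=> nu1.
have [i nui] : exists i, nu i != 0%N.
  apply/existsP; rewrite -[X in is_true X]negbK negb_exists.
  apply/negP => /forallP nu0; move: nu1; rewrite /degree big1 // => i _.
  by apply/eqP; have := nu0 i; rewrite negbK.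
exists i; apply/ffunP => j; rewrite ffunE.
move: nu1; rewrite /degree (bigD1 i)//=.
case nuiE: (nu i) nui => [//|k] _.
rewrite addSn => -[] /eqP; rewrite addn_eq0 => /andP[/eqP k0].
rewrite sum_nat_eq0 => /forallP nuj.
have [->|ji] := eqVneq j i; first by rewrite nuiE k0.
by have := nuj j; rewrite ji => /eqP.
Qed.

Lemma monomial_unit (R : realType) n (z : 'rV[R]_n) (i : 'I_n) :
  monomial z (unit_index i) = z 0 i.
Proof.
rewrite /monomial (bigD1 i)//= ffunE eqxx expr1 big1 ?mulr1// => j /negPf ji.
by rewrite ffunE ji expr0.
Qed.

Lemma monomial_const (R : realType) n (r : R) (nu : {ffun 'I_n -> nat}) :
  monomial (const_mx r) nu = r ^+ degree nu.
Proof.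
by rewrite /monomial /degree -prodrXr; apply: eq_bigr => i _; rewrite mxE.
Qed.

(** The bound is multiplied through by [s] so that no exponent [degree nu - 1]
    appears; in this form it is stable under products, hence it can be proved by
    induction on the factors. *)
Lemma monomial_lipschitz (R : realType) n (z w : 'rV[R]_n) (s d : R)
    (nu : {ffun 'I_n -> nat}) :
  0 < s -> (forall i, `|z 0 i| <= s) -> (forall i, `|w 0 i| <= s) ->
  (forall i, `|z 0 i - w 0 i| <= d) ->
  s * `|monomial z nu - monomial w nu| <= (degree nu)%:R * s ^+ degree nu * d.
Proof.
move=> s0 zs ws zwd.
pose K (x y : R) (k : nat) := [/\ `|x| <= s ^+ k, `|y| <= s ^+ k
  & s * `|x - y| <= k%:R * s ^+ k * d].
have K1 : K 1 1 0%N by split; rewrite ?normr1 ?expr0// subrr normr0; lra.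
have KM x1 y1 k1 x2 y2 k2 : K x1 y1 k1 -> K x2 y2 k2 ->
    K (x1 * x2) (y1 * y2) (k1 + k2)%N.
  move=> [x1s y1s xy1] [x2s y2s xy2]; rewrite /K !normrM exprD.
  split; [exact: ler_pM|exact: ler_pM|].
  have -> : x1 * x2 - y1 * y2 = x1 * (x2 - y2) + (x1 - y1) * y2 by ring.
  apply: le_trans (_ : s * (`|x1| * `|x2 - y2| + `|x1 - y1| * `|y2|) <= _).
    by rewrite ler_pM2l// -!normrM ler_normD.
  have h1 : `|x1| * (s * `|x2 - y2|) <= s ^+ k1 * (k2%:R * s ^+ k2 * d).
    by apply: ler_pM => //; rewrite mulr_ge0// ltW.
  have h2 : (s * `|x1 - y1|) * `|y2| <= (k1%:R * s ^+ k1 * d) * s ^+ k2.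
    by apply: ler_pM => //; rewrite mulr_ge0// ltW.
  rewrite natrD; nra.
have KX i k : K (z 0 i ^+ k) (w 0 i ^+ k) k.
  elim: k => // k IH; rewrite !exprS -[k.+1]add1n; apply: KM => //.
  by split => //; rewrite expr1 mul1r ler_pM2l.
suff [] : K (monomial z nu) (monomial w nu) (degree nu) by [].
rewrite /monomial /degree.
by apply: (@big_ind3 _ _ _ K) => // *; exact: KM.
Qed.

(** The derivative at 0, in the direction [h], of the monomial of exponent
    [nu]: it vanishes unless [nu] has degree 1.  Written as a sum so that it is
    defined for all [nu] at once and can be exchanged with the sum over [nu]. *)
Definition linear_part (R : realType) (n : nat) (h : 'rV[R]_n)
    (nu : {ffun 'I_n -> nat}) : R :=
  \sum_(i < n) (nu == unit_index i)%:R * h 0 i.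

(** The remainder of a monomial after its linear part.  Degrees 0 and 1 leave no
    remainder; in degree [k >= 2] the Lipschitz constant [k s^(k - 1)] is
    compared with [r^k], where [k <= 2^(k - 1)] is absorbed by [2 s <= r].  The
    factor [s] on the right is what makes the remainder small near 0. *)
Lemma monomial_strict (R : realType) n (z w : 'rV[R]_n) (s d r : R)
    (nu : {ffun 'I_n -> nat}) :
  0 < s -> s *+ 2 <= r -> 0 <= d ->
  (forall i, `|z 0 i| <= s) -> (forall i, `|w 0 i| <= s) ->
  (forall i, `|z 0 i - w 0 i| <= d) ->
  r ^+ 2 * `|monomial z nu - monomial w nu - linear_part (z - w) nu|
    <= s *+ 2 * d * r ^+ degree nu.
Proof.
move=> s0 sr d0 zs ws zwd.
have r0 : 0 < r by rewrite (lt_le_trans _ sr)// pmulrn_lgt0.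
have [[i ->]|noti] := pselect (exists i, nu = unit_index i).
  rewrite /linear_part (bigD1 i)//= big1 => [|j ji]; last first.
    by rewrite (inj_eq (@unit_index_inj _)) eq_sym (negPf ji) mul0r.
  rewrite eqxx mul1r addr0 !monomial_unit !mxE subrr normr0 mulr0.
  by rewrite !mulr_ge0 ?exprn_ge0 ?mulrn_wge0// ltW.
have -> : linear_part (z - w) nu = 0.
  rewrite /linear_part big1// => i _; case: eqP => [nui|].
    by case: noti; exists i.
  by rewrite mul0r.
have k1 : degree nu != 1%N by apply/eqP => /degree1P.
rewrite subr0; have := monomial_lipschitz nu s0 zs ws zwd.
set X := `|_|; have X0 : 0 <= X by exact: normr_ge0.
case: (degree nu) k1 => [_|[//|k] _].
  rewrite !mul0r pmulr_rle0// => X_le0.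
  have -> : X = 0 by apply/le_anti; rewrite X_le0.
  by rewrite mulr0 !mulr_ge0 ?mulrn_wge0// ltW.
move=> HX.
have {}HX : X <= k.+2%:R * s ^+ k.+1 * d.
  rewrite -(ler_pM2l s0) (le_trans HX)// exprS le_eqVlt.
  by apply/orP; left; apply/eqP; ring.
have hk : k.+2%:R * s ^+ k <= 2 * r ^+ k.
  apply: le_trans (_ : (2 * 2 ^+ k) * s ^+ k <= _).
    rewrite ler_wpM2r ?exprn_ge0 ?(ltW s0)// -exprS -natrX ler_nat.
    by rewrite (ltn_expl k.+1 (isT : (1 < 2)%N)).
  rewrite -mulrA ler_wpM2l// -exprMn.
  rewrite -mulr_natl in sr.
  by apply: lerXn2r; rewrite ?nnegrE ?mulr_ge0 ?(ltW s0) ?(ltW r0).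
have HX2 : X <= 2 * r ^+ k * (s * d).
  apply: le_trans HX _; rewrite exprS (_ : _ * d = k.+2%:R * s ^+ k * (s * d)).
    by rewrite ler_wpM2r// mulr_ge0// ltW.
  by ring.
have -> : s *+ 2 * d * r ^+ k.+2 = r ^+ 2 * (2 * r ^+ k * (s * d)).
  by rewrite !exprS; ring.
by rewrite ler_wpM2l// exprn_ge0// ltW.
Qed.

(** * Analytic functions are strictly differentiable *)

Lemma summable_bounded (R : realType) (T : choiceType) (u : T -> R) :
  summable [set: T] (fun t => (u t)%:E) ->
  exists M, 0 <= M /\ forall (I : finType) (h : I -> T), injective h ->
    \sum_(i : I) `|u (h i)| <= M.
Proof.
move=> su; set S := (\esum_(t in [set: T]) `|(u t)%:E|)%E.
have S0 : (0 <= S)%E by exact: esum_ge0.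
have fin : S \is a fin_num by rewrite ge0_fin_numE.
exists (fine S); split; first exact: fine_ge0.
move=> I h injh; rewrite -lee_fin fineK//; apply: esum_ge.
exists [set` map h (index_enum I)]; first by split => //; exact: finite_seq.
rewrite -fsbig_seq; last by rewrite map_inj_uniq ?index_enum_uniq.
by rewrite big_map -sumEFin.
Qed.

Definition cube_index (n K : nat) (nu : {ffun 'I_n -> 'I_K}) :
    {ffun 'I_n -> nat} :=
  [ffun i => nat_of_ord (nu i)].

Lemma cube_index_inj n K : injective (@cube_index n K).
Proof.
move=> nu mu /ffunP e; apply/ffunP => i; apply/val_inj.
by have := e i; rewrite !ffunE.
Qed.

(** [1 < K] because the cube of side [K] must contain the exponents of the
    coordinates. *)
Lemma sum_linear_part (R : realType) n K (c : {ffun 'I_n -> nat} -> R)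
    (h : 'rV[R]_n) : (1 < K)%N ->
  \sum_(nu : {ffun 'I_n -> 'I_K})
    c (cube_index nu) * linear_part h (cube_index nu)
  = \sum_(i < n) c (unit_index i) * h 0 i.
Proof.
case: K => [//|[//|K]] _; rewrite /linear_part.
under eq_bigr do rewrite mulr_sumr.
rewrite exchange_big /=; apply: eq_bigr => i _.
pose e : {ffun 'I_n -> 'I_K.+2} := [ffun j => inord (j == i)].
have cube_e : cube_index e = unit_index i.
  by apply/ffunP => j; rewrite !ffunE inordK//; case: eqP.
rewrite (bigD1 e)//= cube_e eqxx mul1r big1 ?addr0// => nu nue.
by rewrite -cube_e (inj_eq (@cube_index_inj _ _)) (negPf nue) mul0r mulr0.
Qed.

Lemma coord_le_norm (R : realType) n (v : 'rV[R]_n) i : `|v 0 i| <= `|v|.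
Proof.
rewrite [leRHS]/Num.norm /= mx_normrE.
exact: (@le_bigmax _ _ _ _ (fun ij : 'I_1 * 'I_n => `|v ij.1 ij.2|) (0, i)).
Qed.

Lemma norm_le_coord (R : realType) n (v : 'rV[R]_n) r :
  0 <= r -> (forall i, `|v 0 i| <= r) -> `|v| <= r.
Proof.
move=> r0 vr; rewrite [leLHS]/Num.norm /= mx_normrE.
by apply: bigmax_le => // -[i j] _ /=; rewrite ord1.
Qed.

(** Absolute convergence at the single point [a + (r, .., r)] bounds the sum of
    all [|c nu| r^|nu|] by some [M]; the monomial estimate, summed against these
    coefficients, then gives the error [2 d M / r^2] on the ball of radius
    [d]. *)
Lemma analytic_strict_derivative (R : realType) n (g : 'rV[R]_n -> R) a :
  analytic_at g a ->
  exists l : 'I_n -> R, forall e, 0 < e -> exists2 d, 0 < d &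
    forall z w, `|z - a| < d -> `|w - a| < d ->
      `|g z - g w - \sum_(i < n) l i * (z - w) 0 i| <= e * `|z - w|.
Proof.
move=> [c /nbhs_normP[r0 /= r0_gt0 r0P]].
pose r := r0 / 2; have r_gt0 : 0 < r by rewrite divr_gt0.
have [|sum_r _] := r0P (a + const_mx r).
  rewrite /ball_ /= opprD addrA subrr sub0r normrN.
  apply: (@le_lt_trans _ _ r); last by rewrite ltr_pdivrMr//; lra.
  by apply: norm_le_coord => [|i]; rewrite ?mxE ?gtr0_norm// ltW.
have [M [M0 {sum_r}cM]] := summable_bounded sum_r.
exists (fun i => c (unit_index i)) => e e0.
(* The first bound makes the monomial estimate apply with [s = d]; the second
   makes the resulting error [2 d M / r^2] at most [e]. *)
pose d := Num.min (r / 2) (e * r ^+ 2 / (2 * (M + 1))).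
have d0 : 0 < d.
  rewrite lt_min !divr_gt0 ?mulr_gt0 ?exprn_gt0//; lra.
have d2r : d *+ 2 <= r.
  by rewrite -mulr_natr -ler_pdivlMr// ge_min lexx.
have dM : d * (2 * (M + 1)) <= e * r ^+ 2.
  rewrite -ler_pdivlMr ?ge_min ?lexx ?orbT//; lra.
exists d => // z w zd wd.
have in_r0 x : `|x - a| < d -> ball_ Num.norm a r0 x.
  move=> xd; rewrite /ball_ /= distrC (lt_le_trans xd)//.
  by move: d2r; rewrite /r -mulr_natr; lra.
have [_ gz] := r0P z (in_r0 z zd); have [_ gw] := r0P w (in_r0 w wd).
set L := \sum_(i < n) _.
have key : (`|g z - g w - L|) <= (d *+ 2 * `|z - w| * M) / r ^+ 2.
  have /(_ _ _ _ _) cvg_diff := cvg_norm (cvgB (cvgB gz gw) (cvg_cst L)).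
  (* The estimate passes from the cubical partial sums to the limit. *)
  apply: (closed_cvg (fun x : R => x <= _) (@closed_le R _) _ _ cvg_diff).
  exists 2%N => // K /= K2.
  rewrite ler_pdivlMr ?exprn_gt0// mulrC /L -(sum_linear_part c (z - w) K2).
  rewrite !fctE -!sumrB.
  apply: le_trans (ler_wpM2l (exprn_ge0 2 (ltW r_gt0)) (ler_norm_sum _ _ _)) _.
  rewrite mulr_sumr.
  apply: le_trans _ (ler_wpM2l _ (cM _ _ (@cube_index_inj n K))); last first.
    by rewrite mulr_ge0// mulrn_wge0// ltW.
  rewrite mulr_sumr; apply: ler_sum => nu _.
  rewrite -/(cube_index nu) -!mulrBr !normrM mulrCA [leRHS]mulrCA.
  rewrite ler_wpM2l//.
  have -> : a + const_mx r - a = const_mx r by rewrite addrC addKr.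
  rewrite monomial_const [X in _ <= _ * X]ger0_norm ?exprn_ge0 ?(ltW r_gt0)//.
  have -> : z - w = (z - a) - (w - a) by rewrite opprB addrA subrK.
  apply: monomial_strict => // i.
  - by rewrite (le_trans (coord_le_norm _ _))// ltW.
  - by rewrite (le_trans (coord_le_norm _ _))// ltW.
  - by rewrite (le_trans _ (coord_le_norm _ i))// !mxE.
apply: le_trans key _; rewrite ler_pdivrMr ?exprn_gt0//.
have nzw : 0 <= `|z - w| by [].
have -> : e * `|z - w| * r ^+ 2 = `|z - w| * (e * r ^+ 2) by ring.
have -> : d *+ 2 * `|z - w| * M = `|z - w| * (d * (2 * M)) by ring.
rewrite ler_wpM2l// (le_trans _ dM)// ler_wpM2l ?(ltW d0)//; lra.
Qed.

(** Stronger than differentiability at [a], as both points vary: it controls [g]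
    uniformly near [a], which is what plain differentiability at the points of
    the path would not give. *)
Definition strict_derivative (R : realType) (n p : nat)
    (g : 'rV[R]_n -> 'rV[R]_p) (a : 'rV[R]_n) (A : 'M[R]_(n, p)) : Prop :=
  forall e, 0 < e -> exists2 d, 0 < d &
    forall z w, `|z - a| < d -> `|w - a| < d ->
      `|g z - g w - (z - w) *m A| <= e * `|z - w|.

Lemma analytic_on_strict_derivative (R : realType) n p
    (U : set 'rV[R]_n) (g : 'rV[R]_n -> 'rV[R]_p) a :
  analytic_on U g -> U a -> exists A, strict_derivative g a A.
Proof.
move=> gU Ua.
have /choice[l lP] := fun j => analytic_strict_derivative (gU a Ua j).
exists (\matrix_(i, j) l j i) => e e0.
have /choice[d dP] : forall j, exists d, 0 < d /\
    forall z w, `|z - a| < d -> `|w - a| < d ->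
    `|g z 0 j - g w 0 j - \sum_(i < n) l j i * (z - w) 0 i| <= e * `|z - w|.
  by move=> j; have [d d0 dP] := lP j e e0; exists d.
exists (\big[Num.min/1]_j d j).
  by apply: lt_bigmin => // j _; have [] := dP j.
move=> z w zd wd; apply: norm_le_coord => [|j]; first by rewrite mulr_ge0// ltW.
have [_ h] := dP j; rewrite !mxE.
under eq_bigr do rewrite [X in _ * X]mxE mulrC.
apply: h; [apply: lt_le_trans zd _|apply: lt_le_trans wd _];
  exact: bigmin_le_cond.
Qed.

(** A crude bound of the operator norm, easier to handle than [op_norm]. *)
Definition entry_sum (R : realType) n p (A : 'M[R]_(n, p)) : R :=
  \sum_j \sum_i `|A i j|.

Lemma entry_sum_ge0 (R : realType) n p (A : 'M[R]_(n, p)) : 0 <= entry_sum A.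
Proof. by apply: sumr_ge0 => j _; apply: sumr_ge0. Qed.

Lemma norm_mulmx_le (R : realType) n p (v : 'rV[R]_n) (A : 'M[R]_(n, p)) :
  `|v *m A| <= entry_sum A * `|v|.
Proof.
apply: norm_le_coord => [|j]; first by rewrite mulr_ge0 ?entry_sum_ge0.
rewrite mxE (le_trans (ler_norm_sum _ _ _))//.
rewrite /entry_sum (bigD1 j)//= mulrDl -[leLHS]addr0 lerD//.
  rewrite mulr_suml ler_sum// => i _.
  by rewrite normrM mulrC ler_wpM2l// coord_le_norm.
by rewrite mulr_ge0// sumr_ge0// => k _; apply: sumr_ge0.
Qed.

Lemma strict_derivative_continuous (R : realType) n p
    (g : 'rV[R]_n -> 'rV[R]_p) a A e :
  strict_derivative g a A -> 0 < e -> exists2 d, 0 < d &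
    forall z, `|z - a| < d -> `|g z - g a| < e.
Proof.
move=> gA e0; have [d d0 dP] := gA 1 ltr01.
have K0 := entry_sum_ge0 A.
exists (Num.min d (e / (entry_sum A + 1))).
  by rewrite lt_min d0 divr_gt0//; lra.
move=> z; rewrite lt_min => /andP[zd]; rewrite ltr_pdivlMr; last lra.
move=> ze; have := dP z a zd; rewrite subrr normr0 => /(_ d0) h.
rewrite -[X in `|X|](subrK ((z - a) *m A)).
have := norm_mulmx_le (z - a) A.
have := ler_normD (g z - g a - (z - a) *m A) ((z - a) *m A).
by lra.
Qed.

Lemma strict_derivative_jacobian (R : realType) n p
    (g : 'rV[R]_n -> 'rV[R]_p) a A :
  strict_derivative g a A -> 'J g a = A.
Proof.
move=> gA.
have dg : 'd g a = mulmxr A :> ('rV[R]_n -> 'rV[R]_p).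
  apply: diff_unique.
    apply: bounded_linear_continuous.
    apply/linear_boundedP; exists (entry_sum A).
    split=> [|r /ltW Ar x]; first exact: num_real.
    by apply: le_trans (norm_mulmx_le _ _) _; rewrite ler_wpM2r.
  apply/eqaddoP => e e0; have [d d0 dP] := gA e e0.
  have [_ nbhs0] := @nbhs_normP _ _ (0 : 'rV[R]_n) (fun h =>
    `|(g \o shift a - (cst (g a) + mulmxr A)) h| <= e * `|h|).
  apply: nbhs0; exists d => // h /=; rewrite sub0r normrN => hd.
  rewrite !fctE /= opprD addrA -[X in _ - X]/(h *m A).
  have := dP (h + a) a; rewrite addrK subrr normr0; exact.
apply/row_matrixP => i; rewrite !rowE /jacobian mul_rV_lin1.
by have := congr1 (fun u => u (delta_mx 0 i)) dg.
Qed.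

(** * The Euclidean norm *)

Section eucl_norm.
Context {R : realType}.

Lemma eucl_norm_ge0 n (v : 'rV[R]_n) : 0 <= eucl_norm v.
Proof. exact: sqrtr_ge0. Qed.

Lemma eucl_norm_sqr n (v : 'rV[R]_n) : eucl_norm v ^+ 2 = \sum_i v 0 i ^+ 2.
Proof. by rewrite sqr_sqrtr// sumr_ge0// => i _; rewrite sqr_ge0. Qed.

Lemma eucl_norm0 n : eucl_norm (0 : 'rV[R]_n) = 0.
Proof.
by rewrite /eucl_norm big1 ?sqrtr0// => i _; rewrite mxE expr0n.
Qed.

Lemma norm_le_eucl n (v : 'rV[R]_n) : `|v| <= eucl_norm v.
Proof.
apply: norm_le_coord => [|i]; first exact: eucl_norm_ge0.
rewrite -(@ler_pXn2r _ 2)// ?nnegrE ?eucl_norm_ge0// eucl_norm_sqr.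
rewrite real_normK ?num_real// (bigD1 i)//= lerDl sumr_ge0// => j _.
exact: sqr_ge0.
Qed.

Lemma eucl_le_norm n (v : 'rV[R]_n) : eucl_norm v <= n%:R * `|v|.
Proof.
rewrite -(@ler_pXn2r _ 2)// ?nnegrE ?eucl_norm_ge0 ?mulr_ge0// eucl_norm_sqr.
apply: le_trans (_ : \sum_(i < n) `|v| ^+ 2 <= _).
  apply: ler_sum => i _; rewrite -[v 0 i ^+ 2]real_normK ?num_real//.
  by rewrite lerXn2r ?nnegrE// coord_le_norm.
rewrite sumr_const card_ord -[leLHS]mulr_natl exprMn ler_wpM2r ?sqr_ge0//.
by rewrite -natrX ler_nat; case: n v => // n _; rewrite expnS leq_pmulr// expn1.
Qed.

Lemma eucl_normZ n (c : R) (v : 'rV[R]_n) :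
  eucl_norm (c *: v) = `|c| * eucl_norm v.
Proof.
rewrite /eucl_norm -sqrtr_sqr -sqrtrM ?sqr_ge0// mulr_sumr.
by congr Num.sqrt; apply: eq_bigr => i _; rewrite mxE exprMn.
Qed.

Lemma eucl_norm_eq0 n (v : 'rV[R]_n) : eucl_norm v = 0 -> v = 0.
Proof.
move=> v0; apply/eqP; rewrite -normr_eq0 -(@normr_le0 R) // normr_id -v0.
exact: norm_le_eucl.
Qed.

(** Cauchy-Schwarz in the form [0 <= |b u - a v|^2], with [a] and [b] the norms
    of [u] and [v]. *)
Lemma eucl_normD n (u v : 'rV[R]_n) :
  eucl_norm (u + v) <= eucl_norm u + eucl_norm v.
Proof.
have [/eucl_norm_eq0 ->|u0] := eqVneq (eucl_norm u) 0.
  by rewrite eucl_norm0 !add0r.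
have [/eucl_norm_eq0 ->|v0] := eqVneq (eucl_norm v) 0.
  by rewrite eucl_norm0 !addr0.
have {}u0 : 0 < eucl_norm u by rewrite lt_def u0 eucl_norm_ge0.
have {}v0 : 0 < eucl_norm v by rewrite lt_def v0 eucl_norm_ge0.
rewrite -(@ler_pXn2r _ 2)// ?nnegrE ?addr_ge0 ?eucl_norm_ge0//.
have -> : eucl_norm (u + v) ^+ 2 =
    eucl_norm u ^+ 2 + eucl_norm v ^+ 2 + 2 * \sum_i u 0 i * v 0 i.
  rewrite !eucl_norm_sqr mulr_sumr -!big_split /=; apply: eq_bigr => i _.
  by rewrite mxE; ring.
set S := \sum_i _; pose a := eucl_norm u; pose b := eucl_norm v.
have : 0 <= \sum_i (b * u 0 i - a * v 0 i) ^+ 2.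
  by apply: sumr_ge0 => i _; exact: sqr_ge0.
have -> : \sum_i (b * u 0 i - a * v 0 i) ^+ 2 =
    2 * (a * b) * (a * b - S).
  transitivity (b ^+ 2 * \sum_i u 0 i ^+ 2 + a ^+ 2 * \sum_i v 0 i ^+ 2
      - 2 * (a * b) * S).
    rewrite /S !mulr_sumr -sumrN -!big_split /=; apply: eq_bigr => i _; ring.
  by rewrite -!eucl_norm_sqr -/a -/b; ring.
rewrite pmulr_rge0 ?mulr_gt0// -/a -/b => abS.
by rewrite sqrrD; lra.
Qed.

(** The supremum defining [op_norm] is an upper bound only if the set is
    bounded, which [entry_sum] ensures; the rest is homogeneity. *)
Lemma op_norm_bound n p (A : 'M[R]_(n, p)) (v : 'rV[R]_n) :
  eucl_norm (v *m A) <= op_norm A * eucl_norm v.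
Proof.
have ubA : has_ubound
    [set eucl_norm (v *m A) | v in [set v : 'rV[R]_n | eucl_norm v <= 1]].
  exists (p%:R * entry_sum A) => _ [w /= w1 <-].
  apply: le_trans (eucl_le_norm _) _; rewrite ler_wpM2l//.
  apply: le_trans (norm_mulmx_le _ _) _.
  by rewrite ler_piMr ?entry_sum_ge0// (le_trans (norm_le_eucl _)).
have [/eucl_norm_eq0 ->|v0] := eqVneq (eucl_norm v) 0.
  by rewrite mul0mx !eucl_norm0 mulr0.
have {}v0 : 0 < eucl_norm v by rewrite lt_def v0 eucl_norm_ge0.
rewrite -ler_pdivrMr// mulrC.
have -> : (eucl_norm v)^-1 * eucl_norm (v *m A)
    = eucl_norm (((eucl_norm v)^-1 *: v) *m A).
  by rewrite -scalemxAl eucl_normZ gtr0_norm ?invr_gt0.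
apply: ub_le_sup => //; exists ((eucl_norm v)^-1 *: v) => //=.
by rewrite eucl_normZ gtr0_norm ?invr_gt0// mulVf// gt_eqF.
Qed.

End eucl_norm.

(** * Uniform contraction and local maneuvers *)

Lemma norm_row_mx_le (R : realType) n m (u : 'rV[R]_n) (v : 'rV[R]_m) r :
  0 <= r -> `|u| <= r -> `|v| <= r -> `|row_mx u v| <= r.
Proof.
move=> r0 ur vr; apply: norm_le_coord => // i; rewrite mxE.
case: splitP => j _; [apply: le_trans ur|apply: le_trans vr];
  exact: coord_le_norm.
Qed.

(** Strict differentiability turns the bound on the partial Jacobian at one
    point into a contraction valid for all nearby parameters at once. *)
Lemma local_contraction (R : realType) n m (Omega : set 'rV[R]_n)
    (D : set 'rV[R]_m) (f : 'rV[R]_n -> 'rV[R]_m -> 'rV[R]_n) x0 a0 :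
  analytic2_on Omega D f -> Omega x0 -> D a0 ->
  op_norm (partial_jacobian f x0 a0) < 1 ->
  exists2 q, 0 <= q < 1 & exists2 d, 0 < d & forall x y a,
    `|x - x0| < d -> `|y - x0| < d -> `|a - a0| < d ->
    eucl_norm (f x a - f y a) <= q * eucl_norm (x - y).
Proof.
move=> fan Ox0 Da0.
have [B FB] : exists B, strict_derivative
    (fun z : 'rV[R]_(n + m) => f (lsubmx z) (rsubmx z)) (row_mx x0 a0) B.
  by apply: (analytic_on_strict_derivative fan); rewrite /= row_mxKl row_mxKr.
have fB e : 0 < e -> exists2 d, 0 < d & forall x y a,
    `|x - x0| < d -> `|y - x0| < d -> `|a - a0| < d ->
    `|f x a - f y a - (x - y) *m usubmx B| <= e * `|x - y|.
  move=> e0; have [d d0 dP] := FB e e0; exists (d / 2).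
    by rewrite divr_gt0.
  move=> x y a xd yd ad.
  have near_base u : `|u - x0| < d / 2 -> `|row_mx u a - row_mx x0 a0| < d.
    move=> ud; rewrite opp_row_mx add_row_mx.
    apply: (@le_lt_trans _ _ (d / 2)); last by lra.
    by apply: norm_row_mx_le; rewrite ?ltW// divr_gt0.
  have := dP _ _ (near_base x xd) (near_base y yd).
  rewrite !row_mxKl !row_mxKr opp_row_mx add_row_mx subrr.
  rewrite -[X in row_mx _ _ *m X]vsubmxK mul_row_col mul0mx addr0 => h.
  apply: le_trans h _; rewrite ler_wpM2l ?(ltW e0)//.
  by apply: norm_row_mx_le; rewrite ?normr0.
rewrite (_ : partial_jacobian f x0 a0 = usubmx B); last first.
  apply: strict_derivative_jacobian => e e0.
  have [d d0 dP] := fB e e0; exists d => // z w zd wd.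
  by apply: dP => //; rewrite subrr normr0.
set C := usubmx B => C1.
(* Half of the gap between [op_norm C] and 1, divided by a constant that pays
   for the passage from the sup norm to the Euclidean norm. *)
pose e := (1 - op_norm C) / (2 * n.+1%:R).
have e0 : 0 < e by rewrite divr_gt0 ?mulr_gt0// subr_gt0.
have [d d0 dP] := fB e e0.
(* The maximum with 0 spares a proof that [op_norm C] is nonnegative. *)
exists (Num.max 0 ((1 + op_norm C) / 2)).
  by rewrite le_max lexx gt_max ltr01/=; lra.
exists d => // x y a xd yd ad.
have := dP x y a xd yd ad; set r := _ - _ *m _ => rle.
have -> : f x a - f y a = (x - y) *m C + r by rewrite /r subrKC.
apply: le_trans (eucl_normD _ _) _.
apply: (@le_trans _ _ ((1 + op_norm C) / 2 * eucl_norm (x - y))); last first.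
  by rewrite ler_wpM2r ?eucl_norm_ge0// le_max lexx orbT.
have -> : (1 + op_norm C) / 2 = op_norm C + (1 - op_norm C) / 2 by field.
rewrite mulrDl lerD ?op_norm_bound//.
apply: le_trans (eucl_le_norm _) _.
apply: (@le_trans _ _ (n.+1%:R * (e * eucl_norm (x - y)))).
  apply: ler_pM => //; first by rewrite ler_nat.
  by apply: le_trans rle _; rewrite ler_wpM2l ?(ltW e0)// norm_le_eucl.
rewrite mulrA le_eqVlt; apply/orP; left; apply/eqP; congr (_ * _).
rewrite /e; have : n.+1%:R != 0 :> R by rewrite pnatr_eq0.
by move: (n.+1%:R) => k k0; field.
Qed.

Lemma open_ball_sub (R : realType) n (U : set 'rV[R]_n) a :
  open U -> U a -> exists2 r, 0 < r & forall x, `|x - a| < r -> U x.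
Proof.
move=> oU Ua; have /nbhs_normP[r /= r0 rU] := open_nbhs_nbhs (conj oU Ua).
by exists r => // x xr; apply: rU; rewrite /ball_ /= distrC.
Qed.

(** The trajectory from [phi b] under the parameter [c] is compared with the
    constant trajectory [phi c]: contraction applies as long as both stay in the
    ball of radius [r] around [phi a], and the contraction itself keeps them
    there. *)
Lemma local_maneuvers (R : realType) n m (Omega : set 'rV[R]_n)
    (D : set 'rV[R]_m) (f : 'rV[R]_n -> 'rV[R]_m -> 'rV[R]_n)
    (D1 : set 'rV[R]_m) (phi : 'rV[R]_m -> 'rV[R]_n) a :
  open Omega -> analytic2_on Omega D f -> open D1 ->
  analytic_path Omega D f D1 phi -> D1 a ->
  op_norm (partial_jacobian f (phi a) a) < 1 ->
  exists2 d, 0 < d & forall b c, `|b - a| < d -> `|c - a| < d ->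
    successful_maneuver Omega f D1 phi b c.
Proof.
move=> oO fan oD1 [D1D phian phiO phifix] D1a fa1.
have [q /andP[q0 q1] [d1 d1_gt0 d1P]] :=
  local_contraction fan (phiO _ D1a) (D1D _ D1a) fa1.
have [d2 d2_gt0 d2P] := open_ball_sub oO (phiO _ D1a).
have [d3 d3_gt0 d3P] := open_ball_sub oD1 D1a.
pose r := Num.min d1 d2; have r0 : 0 < r by rewrite lt_min d1_gt0.
(* [phi] moves by less than [eta], so [phi b] is within the Euclidean distance
   [n (2 eta)] of [phi c]; adding [eta] to return to [phi a] must not exceed
   [r]. *)
pose eta := r / (2 * n%:R + 1).
have n0 : 0 <= n%:R :> R by [].
have eta0 : 0 < eta by rewrite divr_gt0//; lra.
have eta_r : n%:R * (2 * eta) + eta = r by rewrite /eta; field; lra.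
have [A phiA] := analytic_on_strict_derivative phian D1a.
have [d4 d4_gt0 d4P] := strict_derivative_continuous phiA eta0.
exists (Num.min d1 (Num.min d3 d4)); first by rewrite !lt_min d1_gt0 d3_gt0.
move=> b c; rewrite !lt_min => /and3P[_ /d3P D1b /d4P b4].
move=> /and3P[c1 /d3P D1c /d4P c4].
pose B := n%:R * (2 * eta).
have B0 : 0 <= B by rewrite !mulr_ge0// ltW.
have near_base x : eucl_norm (x - phi c) <= B -> `|x - phi a| < r.
  move=> xB; have := norm_le_eucl (x - phi c).
  have := ler_normD (x - phi c) (phi c - phi a); rewrite addrA subrK.
  rewrite -eta_r -/B; lra.
have cc : `|phi c - phi a| < r by apply: near_base; rewrite subrr eucl_norm0.
have r_d1 x : `|x - phi a| < r -> `|x - phi a| < d1.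
  by rewrite lt_min => /andP[].
have traj k : eucl_norm (iterate f k (phi b) c - phi c) <= B * q ^+ k.
  elim: k => [|k IH].
    rewrite expr0 mulr1 (le_trans (eucl_le_norm _))// /B ler_wpM2l//.
    have := ler_normD (phi b - phi a) (phi a - phi c); rewrite addrA subrK.
    by rewrite (distrC (phi a)); lra.
  rewrite /iterate iterS -/(iterate f k (phi b) c) [in X in _ - X]phifix//.
  have IHB : eucl_norm (iterate f k (phi b) c - phi c) <= B.
    by rewrite (le_trans IH)// ler_piMr// exprn_ile1// ltW.
  apply: le_trans (d1P _ _ _ (r_d1 _ (near_base _ IHB)) (r_d1 _ cc) c1) _.
  by rewrite exprS mulrCA ler_wpM2l.
split => //.
  move=> k; apply: d2P.
  suff : `|iterate f k (phi b) c - phi a| < r by rewrite lt_min => /andP[].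
  apply: near_base; rewrite (le_trans (traj k))// ler_piMr//.
  by rewrite exprn_ile1// ltW.
apply/cvgrPdist_lt => e e0.
have qn : `|q| < 1 by rewrite ger0_norm.
have /cvgrPdist_lt/(_ e e0) := cvg_geometric B qn.
apply: filterS => k; rewrite sub0r normrN /geometric/= ger0_norm; last first.
  by rewrite mulr_ge0// exprn_ge0.
by apply: le_lt_trans; rewrite distrC (le_trans (norm_le_eucl _)).
Qed.

(** * Chains in a connected set *)

Definition step_chain (T : Type) (P : set T) (step : T -> T -> Prop)
    (a b : T) :=
  exists (p : nat) (alpha : nat -> T),
    [/\ (0 < p)%N, alpha 0%N = a, alpha p.+1 = b,
        (forall i : nat, (1 <= i <= p)%N -> P (alpha i)) &
        forall i : nat, (i <= p)%N -> step (alpha i) (alpha i.+1)].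

(** The trivial step is taken twice because a chain has at least one
    intermediate point. *)
Lemma step_chain_refl (T : Type) (P : set T) (step : T -> T -> Prop) a :
  P a -> step a a -> step_chain P step a a.
Proof. by move=> Pa saa; exists 1%N, (fun=> a); split. Qed.

Lemma step_chain_rcons (T : Type) (P : set T) (step : T -> T -> Prop) a b c :
  P b -> step_chain P step a b -> step b c -> step_chain P step a c.
Proof.
move=> Pb [p [al [p0 al0 alp alP alstep]]] sbc.
exists p.+1, (fun i => if (i <= p.+1)%N then al i else c); split => //.
- by rewrite ltnn.
- move=> i /andP[i1 ip]; rewrite ip.
  move: ip; rewrite leq_eqVlt => /predU1P[->|ip]; first by rewrite alp.
  by apply: alP; rewrite i1.
- move=> i ip; rewrite ip ltnS.
  move: ip; rewrite leq_eqVlt => /predU1P[->|ip]; first by rewrite ltnn alp.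
  by rewrite ltnS in ip; rewrite ip; exact: alstep.
Qed.

(** The set [S] of points reachable from [a] is open since each point steps to
    all its neighbours, and closed in [P] since all neighbours of a point step
    to it. *)
Lemma connected_chain (R : realType) m (P : set 'rV[R]_m)
    (step : 'rV[R]_m -> 'rV[R]_m -> Prop) :
  open P -> connected P ->
  (forall a, P a -> exists2 d, 0 < d & forall b c,
    `|b - a| < d -> `|c - a| < d -> step b c) ->
  forall a b, P a -> P b -> step_chain P step a b.
Proof.
move=> oP cP loc a b Pa Pb.
have step_refl x : P x -> step x x.
  by move=> /loc[d d0 dP]; apply: dP; rewrite subrr normr0.
pose S := P `&` step_chain P step a.
have nearP x : P x -> \forall y \near x, [/\ P y, step x y & step y x].
  move=> Px; have [d d0 dP] := loc x Px.
  have [e e0 eP] := open_ball_sub oP Px.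
  apply/nbhs_normP; exists (Num.min d e); first by rewrite /= lt_min d0.
  move=> y; rewrite /ball_ /= distrC lt_min => /andP[yd ye].
  by split; [exact: eP|apply: dP|apply: dP]; rewrite // subrr normr0.
suff SP : S = P by have : S b by [rewrite SP]; case.
apply: cP.
- by exists a; split => //; exact: step_chain_refl (step_refl _ _).
- exists S; last by rewrite /S setIA setIid.
  rewrite openE => x [Px Sx]; rewrite /interior.
  apply: filterS (nearP x Px) => y [Py sxy _]; split => //.
  exact: step_chain_rcons Sx sxy.
- exists (~` (P `\` S)).
    apply: open_closedC; rewrite openE => x [Px nSx]; rewrite /interior.
    apply: filterS (nearP x Px) => y [Py _ syx]; split => // -[_ Sy].
    by apply: nSx; split => //; exact: step_chain_rcons Sy syx.
  apply/seteqP; split=> x; first by move=> Sx; split; [case: Sx|case].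
  by move=> [Px nx]; apply: contrapT => nSx; apply: nx.
Qed.

Theorem theorem3 (R : realType) (n m : nat)
    (Omega : set 'rV[R]_n) (D : set 'rV[R]_m)
    (f : 'rV[R]_n -> 'rV[R]_m -> 'rV[R]_n)
    (x0 : 'rV[R]_n) (alpha0 : 'rV[R]_m)
    (D1 : set 'rV[R]_m) (phi : 'rV[R]_m -> 'rV[R]_n)
    (hOmega : is_domain Omega) (hD : is_domain D)
    (hf : analytic2_on Omega D f)
    (hx0 : Omega x0) (halpha0 : D alpha0)
    (hfix : x0 = f x0 alpha0)
    (hcontr : op_norm (partial_jacobian f x0 alpha0) < 1)
    (hphi : maximal_contractive_path_from Omega D f x0 alpha0 D1 phi)
    (alphas alphass : 'rV[R]_m) (hs : D1 alphas) (hss : D1 alphass) :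
  exists (p : nat) (alpha : nat -> 'rV[R]_m),
    [/\ (0 < p)%N, alpha 0%N = alphas, alpha p.+1 = alphass,
        (forall i : nat, (1 <= i <= p)%N -> D1 (alpha i)) &
        forall i : nat, (i <= p)%N ->
          successful_maneuver Omega f D1 phi (alpha i) (alpha i.+1)].
Proof.
have [_ oOmega _] := hOmega.
have [[[_ oD1 cD1] _ [path _] _ contr] _] := hphi.
apply: (connected_chain oD1 cD1) => // a D1a.
exact: (local_maneuvers oOmega hf oD1 path D1a (contr a D1a)).
Qed.
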